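(* Let $X$ be a finite alphabet with at least two letters and let $m\ge -1$ be an integer. The word problem in every finitely generated subgroup of $\mathrm{Pol}(m)$ is solvable in subexponential time.
   Context: Automata. $X^{*}$ is the set of finite words over $X$ and $X^{\omega}$ is the set of right-infinite sequences over $X$. An (invertible) automaton over $X$ consists of a set of states $S$, a transition function $\lambda:S\times X\to S$ and an output function $\pi:S\times X\to X$ such that $\pi(s,\cdot)$ is a permutation of $X$ for every $s\in S$. It is viewed as a directed labeled graph with vertex set $S$ and, for every $s\in S$ and $x\in X$, an arrow $s\to\lambda(s,x)$ labeled $x|\pi(s,x)$ (different letters give different arrows). Each state $s$ acts on $X^{*}\cup X^{\omega}$ by $s(xv)=\pi(s,x)\,\lambda(s,x)(v)$. This action is invertible. All automata are assumed minimized: different states act differently on $X^{\omega}$, and states are identified with the corresponding transformations of $X^{\omega}$. The trivial state, denoted $e$, is the state acting trivially. Polynomial automata. A cycle means a simple directed cycle (loops included). A cycle is trivial if it is a loop at $e$. A finite automaton is polynomial if different nontrivial cycles in it are disjoint (share no vertex). A polynomial automaton has degree $m$ if the largest number of different nontrivial cycles connected by a directed path (met by one directed path) equals $m+1$. The set of all states (as transformations of $X^{\omega}$) of all polynomial automata over $X$ of degree $\le m$ forms a group $\mathrm{Pol}(m)$; $\mathrm{Pol}(-1)$ is the group of finitary transformations, i.e. states $s$ for which there is $n$ such that $s$ fixes nothing but modifies only the first $n$ letters of every sequence in the sense that all its states reached after reading any word of length $n$ are trivial. Word problem. For a group with a fixed finite generating set $S$ (here, finitely many elements of $\mathrm{Pol}(m)$,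 each given as a state of a finite automaton), the word problem asks, given a word $s_1s_2\cdots s_n$ with $s_i\in S\cup S^{-1}$, whether it represents the trivial element. Subexponential time means the running time, as a function of the length $n$ of the input word, grows subexponentially in $n$: it has growth not greater than $a^n$ ($a>1$) and is not equivalent to it, where $f$ has growth not greater than $g$ if there is $C>0$ with $f(n)\le g(Cn)$ for all $n$, and equivalence means this in both directions. *)

(* Defs.v *)
From HB Require Import structures.
From mathcomp Require Import all_boot all_order all_fingroup all_algebra.
From mathcomp Require Import boolp classical_sets.

Set Implicit Arguments.
Unset Strict Implicit.
Unset Printing Implicit Defensive.

(** * The group of all bijections of a type *)

Record bijection (T : Type) := Bijection {
  bij_fun :> T -> T;
  bij_inv : T -> T;
  bij_funK : cancel bij_fun bij_inv;
  bij_invK : cancel bij_inv bij_fun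
}.

Section BijectionGroup.
Variable T : Type.
Implicit Types f g h : bijection T.

Lemma bijection_eq f g : bij_fun f = bij_fun g -> f = g.
Proof.
case: f g => [f f' fK f'K] [g g' gK g'K] /= efg; subst g.
have e : f' = g' by apply/funext => x; rewrite -{1}(g'K x) fK.
by subst g'; rewrite (Prop_irrelevance fK gK) (Prop_irrelevance f'K g'K).
Qed.

Definition bij_one : bijection T := @Bijection T id id (frefl _) (frefl _).

(* Transformations act on the left: [f * g] applies [g] first. *)
Definition bij_mul f g : bijection T :=
  Bijection (can_comp (bij_funK f) (bij_funK g))
            (can_comp (bij_invK g) (bij_invK f)).

Definition bij_opp f : bijection T := Bijection (bij_invK f) (bij_funK f).

Fact bij_mulA : associative bij_mul.
Proof. by move=> f g h; apply: bijection_eq. Qed.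
Fact bij_mul1g : left_id bij_one bij_mul.
Proof. by move=> f; apply: bijection_eq. Qed.
Fact bij_mulg1 : right_id bij_one bij_mul.
Proof. by move=> f; apply: bijection_eq. Qed.
Fact bij_mulVg : left_inverse bij_one bij_opp bij_mul.
Proof. by move=> f; apply: bijection_eq; apply/funext => x /=; exact: bij_funK. Qed.
Fact bij_mulgV : right_inverse bij_one bij_opp bij_mul.
Proof. by move=> f; apply: bijection_eq; apply/funext => x /=; exact: bij_invK. Qed.

End BijectionGroup.

HB.instance Definition _ T := gen_eqMixin (bijection T).
HB.instance Definition _ T := gen_choiceMixin (bijection T).
HB.instance Definition _ T := isGroup.Build (bijection T)
  (@bij_mulA T) (@bij_mul1g T) (@bij_mulg1 T) (@bij_mulVg T) (@bij_mulgV T).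

(** * Automata and their action on infinite sequences *)

Record automaton (X : finType) := Automaton {
  astate : finType;
  trans : astate -> X -> astate;
  output : astate -> {perm X}
}.

Definition omega (X : Type) := nat -> X.

Section Automata.
Variables (X : finType) (A : automaton X).
Local Notation S := (astate A).
Implicit Types (s t : S) (x : X) (w : omega X).

(* [s (x v) = output s x . (trans s x) (v)] *)
Fixpoint transform_rec s w (n : nat) : X :=
  if n is n'.+1 then transform_rec (trans s (w 0)) (fun i => w i.+1) n'
  else output s (w 0).

Definition transform s : omega X -> omega X := transform_rec s.

Definition minimized : Prop := injective transform.

Definition trivial_state s : Prop := transform s = id.

Definition after s (v : seq X) : S := foldl (@trans X A) s v.

(* The arrow [(s, x)] goes from [s] to [trans s x] and is labeled by
   [x | output s x]. *)
Definition arrow : finType := (S * X)%type.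
Definition arrow_src (a : arrow) : S := a.1.
Definition arrow_tgt (a : arrow) : S := trans a.1 a.2.

(* A simple directed cycle is represented by its set of arrows: this set
   determines the cycle up to the choice of its starting point, and parallel
   arrows yield different cycles. *)
Definition simple_cycle (C : {set arrow}) : Prop :=
  exists c : seq arrow,
    [/\ c != [::], path.cycle (fun a b => arrow_tgt a == arrow_src b) c,
        uniq (map arrow_src c) & C = [set a in c]].

Definition trivial_cycle (C : {set arrow}) : Prop :=
  exists s x, [/\ trivial_state s, trans s x = s & C = [set (s, x)]].

Definition nontrivial_cycle (C : {set arrow}) : Prop :=
  simple_cycle C /\ ~ trivial_cycle C.

Definition cycle_vertices (C : {set arrow}) : {set S} := arrow_src @: C.

Definition polynomial_automaton : Prop :=
  forall C D, nontrivial_cycle C -> nontrivial_cycle D -> C <> D ->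
    [disjoint cycle_vertices C & cycle_vertices D].

Definition edge : rel S := fun s t => [exists x, trans s x == t].

(* A set of nontrivial cycles all of which are met by one directed path. *)
Definition on_one_path (CC : {set {set arrow}}) : Prop :=
  (forall C, C \in CC -> nontrivial_cycle C) /\
  exists s (p : seq S), path edge s p /\
    forall C, C \in CC -> exists2 t, t \in s :: p & t \in cycle_vertices C.

Definition degree : int :=
  ((\max_(CC : {set {set arrow}} | `[< on_one_path CC >]) #|CC|)%:Z - 1)%R.

End Automata.

Definition finitary (X : finType) (f : bijection (omega X)) : Prop :=
  exists (A : automaton X) (s : astate A), [/\ minimized A, transform s = f &
    exists n, forall v : seq X, size v = n -> trivial_state (after s v)].

Definition Pol (X : finType) (m : int) : set (bijection (omega X)) :=
  fun f => if m == (- 1)%R then finitary f else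
    exists (A : automaton X) (s : astate A),
      [/\ minimized A, polynomial_automaton A, (degree A <= m)%R & transform s = f].
Arguments Pol X m : clear implicits.

(** * Words in the generators and the word problem *)

(* [(i, false)] stands for the generator [g i], [(i, true)] for its inverse. *)
Definition letter (k : nat) : finType := ('I_k * bool)%type.

Section WordProblem.
Variables (G : groupType) (k : nat) (g : 'I_k -> G).

Definition letter_value (l : letter k) : G :=
  if l.2 then (g l.1)^-1%g else g l.1.

Definition word_value (w : seq (letter k)) : G :=
  (\prod_(l <- w) letter_value l)%g.

Definition generated_subgroup : set G := fun x => exists w, word_value w = x.

Definition word_problem : set (seq (letter k)) := fun w => word_value w = 1%g.

End WordProblem.

(** * Deterministic multitape Turing machines *)

(* The tapes are infinite in both directions; [None] is the blank symbol. *)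
Record turing_machine (Sigma : finType) := TuringMachine {
  extra_tapes : nat;
  work_symbol : finType;
  control : finType;
  start : control;
  (* [Some b] marks a halting state, accepting iff [b = true] *)
  verdict : control -> option bool;
  delta : control -> {ffun 'I_extra_tapes.+1 -> option (Sigma + work_symbol)} ->
    control *
    {ffun 'I_extra_tapes.+1 -> option (Sigma + work_symbol) * option bool}
}.

Section TuringMachines.
Variables (Sigma : finType) (M : turing_machine Sigma).
Local Notation symbol := (option (Sigma + work_symbol M)).
Local Notation ntapes := (extra_tapes M).+1.

(* [Tape l a r]: the head reads [a]; [l] lists the cells on its left and [r]
   those on its right, nearest cell first, all further cells being blank. *)
Record tape := Tape { tleft : seq symbol; thead : symbol; tright : seq symbol }.

Definition write (a : symbol) (t : tape) : tape := Tape (tleft t) a (tright t).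

(* [None]: stay, [Some false]: move left, [Some true]: move right *)
Definition move (d : option bool) (t : tape) : tape :=
  match d with
  | None => t
  | Some false =>
      Tape (behead (tleft t)) (head None (tleft t)) (thead t :: tright t)
  | Some true =>
      Tape (thead t :: tleft t) (head None (tright t)) (behead (tright t))
  end.

Definition config : Type := control M * ('I_ntapes -> tape).

Definition step (c : config) : config :=
  if verdict c.1 is Some _ then c else
  let: (q, act) := delta c.1 [ffun i => thead (c.2 i)] in
  (q, fun i => move (act i).2 (write (act i).1 (c.2 i))).

Definition input_tape (w : seq Sigma) : tape :=
  let cells := [seq Some (inl a) | a <- w] in
  Tape [::] (head None cells) (behead cells).

Definition initial (w : seq Sigma) : config :=
  (start M, fun i => if i == ord0 then input_tape w else Tape [::] None [::]).

Definition decides_in_time (L : set (seq Sigma)) (T : nat -> nat) : Prop :=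
  forall w, exists t b,
    [/\ t <= T (size w), verdict (iter t step (initial w)).1 = Some b
      & b = true <-> L w].

End TuringMachines.

(** * Growth *)

(* Arguments range over positive integers: otherwise [T 0 = 0] alone would
   prevent the exponential function from being bounded by [T]. *)
Definition growth_le (f g : nat -> nat) : Prop :=
  exists2 C, 0 < C & forall n, 0 < n -> f n <= g (C * n).

Definition growth_equiv (f g : nat -> nat) : Prop :=
  growth_le f g /\ growth_le g f.

(* As usual for growth functions, [T] is required to be nondecreasing: [T n]
   bounds the running time on all inputs of length at most [n]. All bases
   [a > 1] give equivalent exponentials. *)
Definition subexponential (T : nat -> nat) : Prop :=
  {homo T : n p / n <= p} /\
  forall a, 1 < a ->
    growth_le T (fun n => a ^ n) /\ ~ growth_equiv T (fun n => a ^ n).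

Definition decidable_in_subexponential_time
    (Sigma : finType) (L : set (seq Sigma)) : Prop :=
  exists (M : turing_machine Sigma) (T : nat -> nat),
    decides_in_time M L T /\ subexponential T.

(* Main.v *)
Require Import Defs.
From mathcomp Require Import all_boot all_order all_fingroup all_algebra.
From mathcomp Require Import boolp classical_sets.
From HB Require Import structures.
From mathcomp Require Import zify.

(* The word problem is even solved in polynomial time. Rank the states of a
   polynomial automaton by the number of reachable states, trivial states having
   rank 0: reading a letter never increases the rank, and as nontrivial cycles are
   disjoint, a nontrivial state keeps its rank under at most one letter. Hence a
   state of rank r has O(d^r) nontrivial sections at level d; and as the prefixes
   of a word w permute each level, only polynomially many vertices v of level at
   most d have a section w|_v with a nontrivial letter.
   If w acts nontrivially, consider a shortest v such that w|_v moves a letter.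
   Steps along v that decrease the rank of some letter number O(|w|); all others
   iterate one fixed function on the letters, so a bounded number of them in a
   row would repeat a word and v could be shortened. Thus |v| = O(|w|), and a
   depth-first search through the sections of w, abandoned at trivial words and
   after too many rank-preserving steps in a row, takes polynomial time. *)

Set Implicit Arguments.
Unset Strict Implicit.
Unset Printing Implicit Defensive.

(** * Polynomials grow subexponentially *)

Lemma leq_exp2rW (m n e : nat) : m <= n -> m ^ e <= n ^ e.
Proof. by case: e => // e; rewrite leq_exp2r. Qed.

Lemma bin_leq_exp2 (n k : nat) : 'C(n, k) <= 2 ^ n.
Proof.
elim: n k => [|n IH] [|k]; rewrite ?bin0 ?bin0n ?expn_gt0 //.
by rewrite binS expnS mul2n -addnn leq_add.
Qed.

Lemma expn_leq_ffact (n e : nat) : n.+1 ^ e <= (n + e) ^_ e.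
Proof.
elim: e => [|e IH]; first by rewrite expn0 ffactn0.
by rewrite expnS addnS ffactSS leq_mul // ltnS leq_addr.
Qed.

(** The falling factorial of [n + e] is ['C(n + e, e)] times the factorial of [e], and the binomial
    coefficient is at most [2 ^ (n + e)]. *)
Lemma expn_leq_exp2 (n e : nat) : n.+1 ^ e <= 2 ^ e * e`! * 2 ^ n.
Proof.
apply: leq_trans (expn_leq_ffact n e) _.
by rewrite -bin_ffact mulnAC -expnD (addnC e) leq_mul2r bin_leq_exp2 orbT.
Qed.

Lemma polynomial_subexponential (C e : nat) :
  subexponential (fun n => C * n.+1 ^ e).
Proof.
split=> [n p np|a a1]; first by rewrite leq_mul2l leq_exp2rW ?orbT.
have two_a n : 2 ^ n <= a ^ n by rewrite leq_exp2rW.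
split=> [|[_ [D D0 hD]]].
  set M := C * (2 ^ e * e`!); exists M.+1 => // n n0.
  apply: leq_trans (two_a _).
  apply: (@leq_trans (M * 2 ^ n)).
    by rewrite -mulnA leq_mul2l expn_leq_exp2 orbT.
  rewrite mulSn addnC expnD leq_mul2r; apply/orP; right.
  apply: leq_trans (ltnW (ltn_expl M (isT : 1 < 2))) _.
  by rewrite leq_exp2l // leq_pmulr.
(* Multiplying a supposed bound [2 ^ n <= C * (D * n).+1 ^ e] by [n.+1] raises the exponent to
   [e.+1], and the right side is still at most [M * 2 ^ n]; so the bound fails once [M < n.+1]. *)
set M := C * D ^ e * (2 ^ e.+1 * e.+1`!); pose n := M.+1.
have n0 : 0 < n by [].
have := hD n n0; apply/negP; rewrite -ltnNge.
apply: leq_trans (two_a n).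
rewrite -(ltn_pmul2r (ltn0Sn n)).
have h : (D * n).+1 ^ e <= D ^ e * n.+1 ^ e.
  by rewrite -expnMn leq_exp2rW // mulnS; lia.
have h' : C * (D * n).+1 ^ e * n.+1 <= C * D ^ e * n.+1 ^ e.+1.
  by rewrite expnSr mulnA leq_mul2r -!mulnA leq_mul2l h !orbT.
apply: leq_ltn_trans h' _.
apply: (@leq_ltn_trans (M * 2 ^ n)).
  by rewrite -(mulnA _ _ (2 ^ n)) leq_mul2l expn_leq_exp2 orbT.
by rewrite mulnC ltn_pmul2l ?expn_gt0 // /n; lia.
Qed.

(** * Ranked automata *)

(** The interface between [Pol] and the search. Unlike being minimized, these properties pass to
    disjoint unions and to formal inverses. *)
Record ranked (X : finType) (A : automaton X) (rank : astate A -> nat) : Prop := {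
  ranked_trans0 : forall s x, rank s = 0 -> trans s x = s;
  ranked_output0 : forall s, rank s = 0 -> output s = 1%g;
  ranked_le : forall s x, rank (trans s x) <= rank s;
  ranked_stay : forall s x y, 0 < rank s ->
    rank (trans s x) = rank s -> rank (trans s y) = rank s -> x = y }.

Section Transform.
Variables (X : finType) (A : automaton X).
Local Notation S := (astate A).
Implicit Types (s t : S) (x : X) (u : omega X).

Definition shift u : omega X := fun i => u i.+1.

Lemma transform0 s u : transform s u 0 = output s (u 0).
Proof. by []. Qed.

Lemma transformS s u n : transform s u n.+1 = transform (trans s (u 0)) (shift u) n.
Proof. by []. Qed.

Lemma trivial_output s x : trivial_state s -> output s x = x.
Proof. by move=> /(congr1 (fun f => f (fun=> x) 0)). Qed.

Lemma trivial_trans s x : trivial_state s -> trivial_state (trans s x).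
Proof.
move=> hs; apply/funext => u; apply/funext => n.
pose v : omega X := fun i => if i is j.+1 then u j else x.
by have := congr1 (fun f => f v n.+1) hs.
Qed.

Lemma trivial_after s (v : seq X) : trivial_state s -> trivial_state (after s v).
Proof. by elim: v s => //= x v IH s hs; exact/IH/trivial_trans. Qed.

Lemma edge_trans s x : edge s (trans s x).
Proof. by apply/existsP; exists x. Qed.

Lemma connect_after s t : connect (@edge X A) s t -> exists v, after s v = t.
Proof.
move=> /connectP[p]; elim: p s => [|r p IH] s /=; first by exists [::].
move=> /andP[/existsP[x /eqP <-] hp] /(IH _ hp)[v hv].
by exists (x :: v).
Qed.

End Transform.

(** * The rank given by the number of reachable states *)

Section ReachabilityRank.
Variables (X : finType) (A : automaton X).
Local Notation S := (astate A).
Local Notation reach := (connect (@edge X A)).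

Definition reach_rank (s : S) : nat :=
  if `[< trivial_state s >] then 0 else #|reach s|.

Lemma reach_rank_eq0 s : reach_rank s = 0 -> trivial_state s.
Proof.
rewrite /reach_rank; case: asboolP => // _ /eqP; rewrite eqn0Ngt => /negP[].
by apply/card_gt0P; exists s; exact: connect0.
Qed.

Lemma reach_rank_trans s x :
  reach_rank (trans s x) <= reach_rank s.
Proof.
rewrite /reach_rank; case: asboolP => // h.
case: asboolP => [/(trivial_trans x)//|_].
apply: subset_leq_card; apply/fintype.subsetP => t.
exact/connect_trans/connect1/edge_trans.
Qed.

(** What is reachable from [trans s x] is reachable from [s]; equal cardinalities make both sets
    equal, so both contain [s]. *)
Lemma reach_rank_stay s x : 0 < reach_rank s ->
  reach_rank (trans s x) = reach_rank s -> reach (trans s x) s.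
Proof.
rewrite /reach_rank; case: asboolP => // _ h0; case: asboolP => [_ e|_ e].
  by rewrite -e in h0.
suff /(_ s) /[!inE] -> : reach (trans s x) =i reach s by exact: connect0.
apply/subset_cardP => //; apply/fintype.subsetP => t.
exact/connect_trans/connect1/edge_trans.
Qed.

(** Minimality makes a trivial state a sink, as its sections act trivially too. Polynomial automata
    and finitary transformations supply the hypothesis on letters leading back in different ways. *)
Lemma reach_rank_ranked : minimized A ->
  (forall s x y, ~ trivial_state s ->
    reach (trans s x) s -> reach (trans s y) s -> x = y) ->
  ranked reach_rank.
Proof.
move=> minA stayA; split.
- move=> s x /reach_rank_eq0 hs; apply: minA.
  by rewrite hs (trivial_trans x hs).
- by move=> s /reach_rank_eq0 hs; apply/permP => x; rewrite perm1 trivial_output.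
- exact: reach_rank_trans.
move=> s x y s0 hx hy; apply: (stayA s); try exact: reach_rank_stay.
by move: s0; rewrite /reach_rank; case: asboolP.
Qed.

Definition consecutive (a b : arrow A) : bool := arrow_tgt a == arrow_src b.

Lemma arrow_path t p : path (@edge X A) t p ->
  exists q : seq (arrow A), map (@arrow_src X A) q = belast t p /\
    forall a, arrow_tgt a = t ->
      path consecutive a q /\ arrow_tgt (last a q) = last t p.
Proof.
elim: p t => [|r p IH] t /=; first by exists [::].
move=> /andP[/existsP[y /eqP ey] /IH[q [eq hq]]].
exists ((t, y) :: q); split=> [|a ea] /=; first by rewrite eq.
have [h1 h2] := hq (t, y) ey.
by rewrite /consecutive ea eqxx.
Qed.

Lemma simple_cycle_through s x : reach (trans s x) s ->
  exists C : {set arrow A}, [/\ simple_cycle C, (s, x) \in C &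
    forall y, (s, y) \in C -> y = x].
Proof.
move=> /connectP[p0 hp0 es].
case: (shortenP hp0) es => p hp up _ es.
have [q [eq hq]] := arrow_path hp.
have [hq1 hq2] := hq (s, x) (erefl _).
have us : uniq (s :: belast (trans s x) p).
  by move: up; rewrite lastI -es rcons_uniq.
exists [set a in (s, x) :: q]; split.
- exists ((s, x) :: q); split=> //; last by rewrite /= eq.
  by rewrite /= rcons_path -/consecutive hq1 /consecutive hq2 -es eqxx.
- by rewrite !inE eqxx.
move=> y; rewrite !inE => /orP[/eqP[->]//|/(map_f (@arrow_src X A))].
by rewrite eq => h; move: us; rewrite /= h.
Qed.

(** Each of the two letters starts a simple cycle through [s], nontrivial because [s] is. Sharing
    [s], the two cycles coincide, and a simple cycle leaves [s] by one letter only. *)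
Lemma polynomial_stay : polynomial_automaton A ->
  forall s x y, ~ trivial_state s ->
    reach (trans s x) s -> reach (trans s y) s -> x = y.
Proof.
move=> polyA s x y ns /simple_cycle_through[C [hC Cx _]].
move=> /simple_cycle_through[D [hD Dy Dyu]].
have nontriv (E : {set arrow A}) z : simple_cycle E -> (s, z) \in E ->
    nontrivial_cycle E.
  move=> hE Ez; split=> // -[t [v [ht _ eE]]]; apply: ns.
  by move: Ez; rewrite eE inE => /eqP[->].
case: (pselect (C = D)) => [CD|CD]; first by apply: Dyu; rewrite -CD.
have := polyA _ _ (nontriv _ _ hC Cx) (nontriv _ _ hD Dy) CD.
move=> /pred0P/(_ s) /=; rewrite -[RHS]/false => /negbT/negP[].
by apply/andP; split; apply/imsetP; [exists (s, x)|exists (s, y)].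
Qed.

End ReachabilityRank.

(** * Finitary transformations *)

Section Reachable.
Variables (X : finType) (A : automaton X) (s0 : astate A).

(** [finitary] constrains only the sections of one state, so the rank is taken on the part reachable
    from it. *)
Definition reachable_part : automaton X :=
  @Automaton X {t : astate A | connect (@edge X A) s0 t}
    (fun t x => exist _ (trans (val t) x)
       (connect_trans (valP t) (connect1 (edge_trans (val t) x))))
    (fun t => output (val t)).

Lemma transform_reachable_part (t : astate reachable_part) :
  transform t = transform (val t).
Proof.
apply/funext => u; apply/funext => n.
by elim: n t u => // n IH t u; rewrite !transformS IH.
Qed.

Lemma after_reachable_part (t : astate reachable_part) v :
  val (after t v) = after (val t) v.
Proof. by elim: v t => //= x v IH t; rewrite IH. Qed.

End Reachable.

Lemma after_cat (X : finType) (A : automaton X) (s : astate A) v w :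
  after s (v ++ w) = after (after s v) w.
Proof. exact: foldl_cat. Qed.

Lemma finitary_ranked (X : finType) (f : bijection (omega X)) : finitary f ->
  exists (A : automaton X) (rank : astate A -> nat) (s : astate A),
    ranked rank /\ transform s = f.
Proof.
case=> A [s [minA es [n hn]]].
pose s' : astate (reachable_part s) := exist _ s (connect0 _ s).
exists (reachable_part s), (@reach_rank _ _), s'; split; last first.
  by rewrite transform_reachable_part.
apply: reach_rank_ranked => [t t'|t x y nt tx _].
  by rewrite !transform_reachable_part => /minA/val_inj.
case: nt.
have [v hv] : exists v, after s v = val t.
  exact/connect_after/(valP t).
have [u hu] := connect_after tx.
have loop j : after t (flatten (nseq j (x :: u))) = t.
  by elim: j => // j IH; rewrite /= -/(after _ _) after_cat hu IH.
(* Going [n] times round the cycle through [t] gives a word of length at least [n] leading to [t].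
   Its prefix of length [n] already leads to a trivial state, so [t] is trivial. *)
pose w := v ++ flatten (nseq n (x :: u)).
have ew : after s w = val t.
  by rewrite /w after_cat hv -after_reachable_part loop.
have nw : n <= size w.
  rewrite size_cat size_flatten /shape map_nseq sumn_nseq /=; lia.
rewrite /trivial_state transform_reachable_part -ew -(cat_take_drop n w) after_cat.
exact/trivial_after/hn/size_takel.
Qed.

Lemma Pol_ranked (X : finType) (m : int) (f : bijection (omega X)) : Pol X m f ->
  exists (A : automaton X) (rank : astate A -> nat) (s : astate A),
    ranked rank /\ transform s = f.
Proof.
rewrite /Pol; case: ifP => _; first exact: finitary_ranked.
case=> A [s [minA polyA _ es]].
exists A, (@reach_rank _ _), s; split=> //.
exact: (reach_rank_ranked minA (polynomial_stay polyA)).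
Qed.

(** * One ranked automaton for all generators and their inverses *)

Section SignedSum.
Variables (X : finType) (k : nat) (A : 'I_k -> automaton X).
Variable rank : forall i, astate (A i) -> nat.

(* The state [(s, true)] is the inverse of the state [(s, false)]. *)
Definition signed_sum : automaton X :=
  @Automaton X ({i : 'I_k & astate (A i)} * bool)%type
    (fun s x => let: existT i t := s.1 in
      (existT (fun i => astate (A i)) i
        (trans t (if s.2 then (output t)^-1%g x else x)), s.2))
    (fun s => let: existT i t := s.1 in
      if s.2 then (output t)^-1%g else output t).

Definition signed_rank (s : astate signed_sum) : nat := rank (tagged s.1).

Definition signed_state i (t : astate (A i)) (b : bool) : astate signed_sum :=
  (existT (fun i => astate (A i)) i t, b).

Lemma signed_ranked : (forall i, ranked (@rank i)) -> ranked signed_rank.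
Proof.
move=> hr; split.
- by move=> [[i t] b] x; rewrite /signed_rank /= => h; rewrite (ranked_trans0 (hr i)).
- move=> [[i t] b]; rewrite /signed_rank /= => h.
  by rewrite (ranked_output0 (hr i)) // invg1 if_same.
- by move=> [[i t] b] x; exact: (ranked_le (hr i)).
move=> [[i t] b] x y; rewrite /signed_rank /= => t0 hx hy.
have := ranked_stay (hr i) t0 hx hy.
by case: b {hx hy} => // /perm_inj.
Qed.

Lemma transform_signed_pos i (t : astate (A i)) :
  transform (signed_state t false) = transform t.
Proof.
apply/funext => u; apply/funext => n.
by elim: n t u => // n IH t u; rewrite !transformS IH.
Qed.

Lemma transform_signed_neg i (t : astate (A i)) :
  cancel (transform t) (transform (signed_state t true)).
Proof.
move=> u; apply/funext => n.
elim: n t u => [|n IH] t u; first by rewrite !transform0 /= permK.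
have e : trans (signed_state t true) (transform t u 0) =
    signed_state (trans t (u 0)) true.
  by rewrite /= /signed_state /= permK.
rewrite transformS e.
exact: (IH (trans t (u 0)) (shift u)).
Qed.

End SignedSum.

(** The states realize inverses of letters because a word of states acts by its first letter first,
    whereas a product in the group applies its last factor first: the word acts as the inverse of
    its value. *)
Lemma letter_states (X : finType) (k : nat) (g : 'I_k -> bijection (omega X)) :
  (forall i, exists (A : automaton X) (rank : astate A -> nat) (s : astate A),
    ranked rank /\ transform s = g i) ->
  exists (A : automaton X) (rank : astate A -> nat) (q : letter k -> astate A),
    ranked rank /\ forall l, transform (q l) = (letter_value g l)^-1%g.
Proof.
move=> hg.
pose T := {A : automaton X & ((astate A -> nat) * astate A)%type}.
have /choice[F hF] : forall i, exists F : T,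
    ranked (tagged F).1 /\ transform (tagged F).2 = g i.
  move=> i; have [A [r [s hs]]] := hg i.
  by exists (existT (fun A : automaton X => ((astate A -> nat) * astate A)%type) A (r, s)).
exists (signed_sum (fun i => tag (F i))),
  (signed_rank (fun i => (tagged (F i)).1)),
  (fun l => signed_state (A := fun i => tag (F i)) (tagged (F l.1)).2 (~~ l.2)).
split; first by apply: signed_ranked => i; case: (hF i).
move=> [i b]; have [_ es] := hF i.
rewrite /letter_value /=; case: b => /=.
  by rewrite transform_signed_pos es.
apply/funext => u; rewrite -{1}(bij_invK (g i) u) -es.
exact: transform_signed_neg.
Qed.

(** * Sections of words of states *)

Section Words.
Variables (X : finType) (A : automaton X).
Local Notation S := (astate A).
Implicit Types (s q : S) (x : X) (u : omega X) (ws : seq S).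

(* A word of states acts by its first letter first. *)
Definition word_act ws u : omega X := foldl (fun u q => transform q u) u ws.

Definition word_output ws x : X := foldl (fun x q => output q x) x ws.

Fixpoint word_section ws x : seq S :=
  if ws is q :: ws' then trans q x :: word_section ws' (output q x) else [::].

Definition word_trivial ws : Prop :=
  forall v x, word_output (foldl word_section ws v) x = x.

Lemma size_word_section ws x : size (word_section ws x) = size ws.
Proof. by elim: ws x => //= q ws IH x; rewrite IH. Qed.

Lemma word_act0 ws u : word_act ws u 0 = word_output ws (u 0).
Proof. by elim: ws u => //= q ws IH u; rewrite -[LHS]/(word_act ws _ 0) IH. Qed.

Lemma word_actS ws u :
  shift (word_act ws u) = word_act (word_section ws (u 0)) (shift u).
Proof. by elim: ws u => //= q ws IH u; rewrite -/(word_act ws _) IH. Qed.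

Lemma word_act_id ws : word_act ws = id <-> word_trivial ws.
Proof.
split=> [|triv].
  move=> + v; elim: v ws => [|y v IH] ws hws x.
    by have := congr1 (fun f => f (fun=> x) 0) hws; rewrite word_act0.
  apply: IH; apply/funext => u.
  pose u' : omega X := fun i => if i is j.+1 then u j else y.
  by have := word_actS ws u'; rewrite hws => <-.
apply/funext => u; apply/funext => n.
elim: n ws u triv => [|n IH] ws u triv; first by rewrite word_act0; exact: (triv [::]).
rewrite -[LHS]/(shift (word_act ws u) n) word_actS IH // => v.
exact: (triv (u 0 :: v)).
Qed.

Lemma word_value_trivial (k : nat) (g : 'I_k -> bijection (omega X))
    (q : letter k -> S) :
  (forall l, transform (q l) = (letter_value g l)^-1%g) ->
  forall w, word_value g w = 1%g <-> word_trivial (map q w).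
Proof.
move=> hq w; rewrite -word_act_id.
have -> : word_act (map q w) = ((word_value g w)^-1)%g.
  apply/funext => u; rewrite /word_value; elim: w u => [|l w IH] u.
    by rewrite big_nil invg1.
  by rewrite big_cons invMg /= -/(word_act _ _) IH hq.
split=> [->|h]; first by rewrite invg1.
by apply: invg_inj; apply: bijection_eq; rewrite h invg1.
Qed.

(** Outputs are permutations: while [x] runs through the alphabet, so does the letter read at each
    position of the word. *)
Lemma sum_word_section (f : S -> nat) ws :
  \sum_x \sum_(q <- word_section ws x) f q = \sum_(q <- ws) \sum_x f (trans q x).
Proof.
elim: ws => [|q ws IH]; first by rewrite big_nil big1 // => x _; rewrite big_nil.
rewrite big_cons -IH [X in _ = _ + X](reindex_inj (@perm_inj _ (output q))).
rewrite -big_split /=.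
by apply: eq_bigr => x _; rewrite big_cons.
Qed.

End Words.

(** * The pruned search: correctness and size *)

Section Search.
Variables (X : finType) (A : automaton X) (rank : astate A -> nat).
Hypothesis rankP : ranked rank.
(* The number of consecutive rank-preserving steps after which a branch of the
   search is abandoned. *)
Variable patience : nat.
Local Notation S := (astate A).
Implicit Types (s q : S) (x : X) (ws : seq S) (c : nat).

Definition nontriv ws : bool := has (fun q => 0 < rank q) ws.

Fixpoint stays ws x : bool :=
  if ws is q :: ws' then (rank (trans q x) == rank q) && stays ws' (output q x)
  else true.

Definition rank_sum ws : nat := \sum_(q <- ws) rank q.

(** The function that rank-preserving steps apply to each letter. At positive rank [y] is unique, at
    rank 0 every choice gives back [q]; the default [q] is for states that lose rank under every
    letter. *)
Definition stay_succ q : S :=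
  if [pick y | rank (trans q y) == rank q] is Some y then trans q y else q.

Definition alive c ws : bool := nontriv ws && (c < patience).

Definition next_count c ws x : nat := if stays ws x then c.+1 else 0.

(* All sections met by the pruned search below [ws] fix the first letter. *)
Inductive good c ws : Prop := Good of
  (alive c ws -> forall x, word_output ws x = x) &
  (alive c ws -> forall x, good (next_count c ws x) (word_section ws x)).

Lemma trans_stay q x : rank (trans q x) = rank q -> trans q x = stay_succ q.
Proof.
move=> hx; rewrite /stay_succ; case: pickP => [y /eqP hy|/(_ x)]; last by rewrite hx eqxx.
have [q0|q0] := posnP (rank q); first by rewrite !(ranked_trans0 rankP).
by rewrite (ranked_stay rankP q0 hx hy).
Qed.

Lemma stays_section ws x : stays ws x -> word_section ws x = map stay_succ ws.
Proof. by elim: ws x => //= q ws IH x /andP[/eqP/trans_stay -> /IH ->]. Qed.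

Lemma rank_sum_section ws x :
  rank_sum (word_section ws x) + ~~ stays ws x <= rank_sum ws.
Proof.
rewrite /rank_sum; elim: ws x => [|q ws IH] x; first by rewrite big_nil.
rewrite /= !big_cons; have := IH (output q x); have := ranked_le rankP q x.
by case: eqP => /=; lia.
Qed.

Lemma trivial_word_output ws x : ~~ nontriv ws -> word_output ws x = x.
Proof.
rewrite /word_output; elim: ws x => //= q ws IH x.
rewrite negb_or -eqn0Ngt => /andP[/eqP/(ranked_output0 rankP) -> /IH].
by rewrite perm1.
Qed.

Lemma trivial_word_section ws x : ~~ nontriv ws -> ~~ nontriv (word_section ws x).
Proof.
elim: ws x => //= q ws IH x.
rewrite !negb_or -!eqn0Ngt => /andP[/eqP q0 /IH ->].
by rewrite (ranked_trans0 rankP) // q0.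
Qed.

Lemma nontriv_moved ws v x :
  word_output (foldl (@word_section X A) ws v) x != x -> nontriv ws.
Proof.
apply: contraNT; elim: v ws => [|y v IH] ws h /=.
  by rewrite trivial_word_output.
exact/IH/trivial_word_section.
Qed.

(** A lexicographic measure: a step either uses up patience or lowers the rank sum, whose weight
    [patience.+1] outbalances the restored patience. *)
Definition fuel c ws : nat := rank_sum ws * patience.+1 + (patience - c).

Lemma fuel_section c ws x : c < patience ->
  fuel (next_count c ws x) (word_section ws x) < fuel c ws.
Proof.
move=> hc; rewrite /fuel /next_count; have := rank_sum_section ws x.
case: (stays ws x) => /=; move: (rank_sum _) (rank_sum ws) => a b.
  rewrite addn0 => ab; rewrite -addnS leq_add ?leq_mul2r ?ab ?orbT //.
  by rewrite -subSn // subSS.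
rewrite addn1 => ab; apply: (@leq_trans (a.+1 * patience.+1)); last first.
  by apply: leq_trans (leq_addr _ _); rewrite leq_mul2r ab orbT.
by rewrite mulSn; lia.
Qed.

(** A trivial word passes every test, but [good] is inductive, so the search has to end: [fuel]
    decreases along each branch. *)
Lemma word_trivial_good c ws : word_trivial ws -> good c ws.
Proof.
have [n] := ubnP (fuel c ws).
elim: n c ws => [|n IH] c ws; first by rewrite ltn0.
move=> hn triv.
split=> [_ x|/andP[_ hc] x]; first exact: (triv [::]).
apply: IH => [|v]; last exact: (triv (x :: v)).
exact: leq_trans (fuel_section _ _ hc) hn.
Qed.

Definition moved_at ws d : bool :=
  [exists v : d.-tuple X, exists x,
    word_output (foldl (@word_section X A) ws v) x != x].

Lemma moved_atS ws d : moved_at ws d.+1 = [exists x, moved_at (word_section ws x) d].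
Proof.
apply/existsP/existsP => [[v /existsP[x hx]]|[y /existsP[v /existsP[x hx]]]].
  exists (thead v); apply/existsP; exists [tuple of behead v]; apply/existsP; exists x.
  by move: hx; rewrite (tuple_eta v).
by exists [tuple of y :: v]; apply/existsP; exists x.
Qed.

Lemma moved_at_section ws d x : moved_at (word_section ws x) d -> moved_at ws d.+1.
Proof. by rewrite moved_atS => h; apply/existsP; exists x. Qed.

Lemma moved_at_nontriv ws d : moved_at ws d -> nontriv ws.
Proof. by case/existsP => v /existsP[x /nontriv_moved]. Qed.

Definition first_moved ws d : Prop :=
  moved_at ws d /\ forall d', moved_at ws d' -> d <= d'.

(* The words met during [c] consecutive rank-preserving steps on a shortest
   path to a moved letter are pairwise different, as they have different
   distances to it. *)
Lemma patience_enough ws0 c d : #|{ffun S -> S}| <= patience ->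
  (forall i, i <= c -> first_moved (map (iter i stay_succ) ws0) (d + (c - i))) ->
  c < patience.
Proof.
move=> patienceP h.
pose f (i : 'I_c.+1) : {ffun S -> S} := [ffun q => iter i stay_succ q].
have f_inj : injective f.
  move=> i j /ffunP eij; apply/val_inj => /=.
  have e : map (iter i stay_succ) ws0 = map (iter j stay_succ) ws0.
    by apply: eq_map => q; have := eij q; rewrite !ffunE.
  have [hi hi'] := h i (ltn_ord i); have [hj hj'] := h j (ltn_ord j).
  rewrite e in hi hi'; have := hi' _ hj; have := hj' _ hi.
  by have := ltn_ord i; have := ltn_ord j; lia.
by apply: leq_trans patienceP; have := leq_card f f_inj; rewrite card_ord.
Qed.

(** Induction on the distance [d] to the nearest moved letter. The current run of [c]
    rank-preserving steps began at [ws0], and all its words lie on a shortest path; hence patience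
    is not exhausted before the moved letter is met. *)
Lemma first_moved_not_good d c ws ws0 : #|{ffun S -> S}| <= patience -> ws = map (iter c stay_succ) ws0 ->
  (forall i, i <= c -> first_moved (map (iter i stay_succ) ws0) (d + (c - i))) ->
  ~ good c ws.
Proof.
move=> patienceP; elim: d c ws ws0 => [|d IH] c ws ws0 ews hist [].
all: have al : alive c ws by
  rewrite /alive (patience_enough patienceP hist) andbT;
  have [+ _] := hist c (leqnn c); rewrite -ews; exact: moved_at_nontriv.
all: move=> /(_ al) ho /(_ al) hs.
all: have := hist c (leqnn c); rewrite subnn addn0 -ews => -[hm hmin].
  by case/existsP: hm => v /existsP[x]; rewrite (tuple0 v) /= ho eqxx.
move: hm; rewrite moved_atS => /existsP[x hx].
have fm : first_moved (word_section ws x) d.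
  by split=> // d' /moved_at_section/hmin.
(* A rank-preserving step extends the current run; any other step starts a new one at the section,
   with counter 0. *)
have := hs x; rewrite /next_count; case: ifP => hst.
  apply: (IH _ _ ws0) => [|i].
    by rewrite stays_section // ews -map_comp.
  rewrite leq_eqVlt => /orP[/eqP ->|hi].
    rewrite subnn addn0; move: fm; rewrite stays_section // ews -map_comp.
    by congr (first_moved _ _).
  by rewrite subSn // addnS -addSn; exact: hist.
apply: (IH _ _ (word_section ws x)); first by rewrite map_id.
by case=> // _; rewrite map_id addn0.
Qed.

Lemma good_word_trivial ws : #|{ffun S -> S}| <= patience ->
  good 0 ws -> word_trivial ws.
Proof.
move=> patienceP gd v x; apply/eqP; apply/negPn/negP => hx.
have ex : exists d, moved_at ws d.
  by exists (size v); apply/existsP; exists (in_tuple v); apply/existsP; exists x.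
case: (ex_minnP ex) => d hd hmin.
apply: (@first_moved_not_good d 0 ws ws) => //; first by rewrite map_id.
by case=> // _; rewrite map_id addn0.
Qed.

(* The number of pairs made of a level below [d] and a nontrivial section at it. *)
Fixpoint activity d q : nat :=
  if d is d'.+1 then (0 < rank q) + \sum_x activity d' (trans q x) else 0.

Lemma activity_trivial d q : rank q = 0 -> activity d q = 0.
Proof.
elim: d q => //= d IH q q0; rewrite q0 big1 // => x _.
by rewrite (ranked_trans0 rankP) // IH.
Qed.

Lemma activityS d q : activity d q <= activity d.+1 q.
Proof.
elim: d q => //= d IH q; rewrite leq_add2l; apply: leq_sum => x _; exact: IH.
Qed.

Lemma activity_le d d' q : d <= d' -> activity d q <= activity d' q.
Proof.
move=> /subnK <-; elim: (d' - d) => // e IH.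
exact: leq_trans IH (activityS _ _).
Qed.

(* The branches that keep the rank contribute one term, all others a lower power. *)
Lemma activity_bound d q : activity d q < (#|X|.+1 * d).+1 ^ rank q.
Proof.
elim: d q => [|d IH] q; first by rewrite /= expn_gt0.
have [q0|q0] := posnP (rank q); first by rewrite activity_trivial ?expn_gt0.
rewrite /= q0; set K := #|X|.+1; set B := (K * d).+1.
have [r er] : exists r, rank q = r.+1 by exists (rank q).-1; rewrite prednK.
have lower x : rank (trans q x) <> rank q -> activity d (trans q x) <= B ^ r.
  move=> ne; apply/ltnW/(leq_trans (IH _)); rewrite leq_pexp2l //.
  by have := ranked_le rankP q x; lia.
have sum_le : \sum_x activity d (trans q x) < B ^ r.+1 + #|X| * B ^ r.
  have [y /eqP hy|no] := pickP (fun x => rank (trans q x) == rank q).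
    rewrite (bigD1 y) //= -addSn; apply: leq_add; first by rewrite -er -hy IH.
    apply: (@leq_trans (\sum_(x : X) B ^ r)); last by rewrite sum_nat_const.
    rewrite [leqRHS](bigD1 y) //=; apply/(leq_trans _ (leq_addl _ _))/leq_sum.
    move=> x /eqP xy; apply: lower => hx; apply: xy.
    exact: (ranked_stay rankP q0 hx hy).
  rewrite -add1n; apply: leq_add; first by rewrite expn_gt0.
  apply: (@leq_trans (\sum_(x : X) B ^ r)); last by rewrite sum_nat_const.
  by apply: leq_sum => x _; apply: lower; have /eqP := no x.
(* The right side is [B ^ r * (B + K)]: as [K] exceeds [#|X|] by one, it covers the children and [q]
   itself. *)
rewrite er; apply: (@leq_trans (B ^ r * (K * d.+1).+1)).
  have : 0 < B ^ r by rewrite expn_gt0.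
  move: sum_le; rewrite expnS /K mulnS -/K -/B /B.
  by move: (\sum_x _) (B ^ r) => a b; rewrite /K; nia.
by rewrite expnSr leq_mul2r leq_exp2rW ?orbT // ltnS leq_mul2l leqnSn orbT.
Qed.

(* Reading a letter through a word permutes the alphabet, so the activities of all
   children of a word add up to its own activity one level deeper, less its number
   of nontrivial letters: [potential] bounds the size of the search tree. *)
Definition potential c ws : nat :=
  (#|X|.+1 * \sum_(q <- ws) activity (fuel c ws) q).+1.

Lemma potential_children c ws : alive c ws ->
  \sum_x potential (next_count c ws x) (word_section ws x) < potential c ws.
Proof.
case/andP=> nt hc; rewrite /potential.
have [d hd] : exists d, fuel c ws = d.+1.
  by exists (fuel c ws).-1; rewrite prednK // /fuel; lia.
have hchild x : fuel (next_count c ws x) (word_section ws x) <= d.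
  by rewrite -ltnS -hd fuel_section.
rewrite ltnS hd /= big_split /= -sum_word_section mulnDr.
(* A single nontrivial letter, with weight [#|X|.+1], pays for the summand 1 in the potential of
   each child. *)
have nt1 : 0 < \sum_(q <- ws) (0 < rank q).
  by rewrite lt0n -big_mkcond /= sum1_count -lt0n -has_count.
apply: (@leq_trans (\sum_(x : X) 1 + #|X|.+1 *
    \sum_x \sum_(q <- word_section ws x) activity d q)).
  rewrite big_distrr /= -big_split /=; apply: leq_sum => x _.
  rewrite add1n ltnS leq_mul2l; apply: leq_sum => q _; exact: activity_le.
rewrite leq_add2r sum1_card; apply: leq_trans (leqnSn _) _.
by rewrite leq_pmulr.
Qed.

(** Fuel is linear in the length of the word, so each letter has activity of degree at most [r], the
    largest rank; summing over the letters costs one more degree. *)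
Lemma potential_bound : exists C e, forall ws, potential 0 ws <= C * (size ws).+1 ^ e.
Proof.
set r := \max_q rank q.
have rank_le q : rank q <= r by exact: leq_bigmax.
have fuel_le ws : fuel 0 ws <= (r * patience.+1 + patience) * (size ws).+1.
  have : rank_sum ws <= r * size ws.
    rewrite /rank_sum; elim: ws => [|q ws IH]; first by rewrite big_nil.
    by rewrite big_cons /= mulnS leq_add.
  by rewrite /fuel; move: (rank_sum _) (size _) => a b; nia.
set F := r * patience.+1 + patience.
exists (#|X|.+1 * (#|X|.+1 * F).+1 ^ r).+1, r.+1 => ws.
set n1 := (size ws).+1.
have act_le q : activity (fuel 0 ws) q <= (#|X|.+1 * F).+1 ^ r * n1 ^ r.
  apply: leq_trans (ltnW (activity_bound _ _)) _.
  rewrite -expnMn; apply: (@leq_trans ((#|X|.+1 * fuel 0 ws).+1 ^ r)).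
    by rewrite leq_pexp2l.
  apply: leq_exp2rW; rewrite [leqRHS]mulSn -mulnA -add1n leq_add // leq_mul2l.
  by rewrite fuel_le orbT.
have sum_le : \sum_(q <- ws) activity (fuel 0 ws) q <=
    size ws * ((#|X|.+1 * F).+1 ^ r * n1 ^ r).
  rewrite mulnC -(count_predT ws) -iter_addn_0 -big_const_seq.
  by apply: leq_sum => q _; exact: act_le.
rewrite /potential [leqRHS]mulSn -add1n leq_add ?expn_gt0 // -mulnA leq_mul2l.
by rewrite (leq_trans sum_le) ?orbT // expnS mulnCA leq_mul2l leq_mul2r leqnSn !orbT.
Qed.

End Search.

(** * Two-tape machines up to trailing blanks *)

Section TwoTapes.
Variables (Sigma work ctrl : finType) (start0 : ctrl) (halt : ctrl -> option bool).
Local Notation symbol := (option (Sigma + work)).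
Local Notation action := (symbol * option bool)%type.
Variable next : ctrl -> symbol -> symbol -> ctrl * action * action.

Definition two_tape_machine : turing_machine Sigma :=
  @TuringMachine Sigma 1 work ctrl start0 halt
    (fun p f => let: (p', a0, a1) := next p (f ord0) (f ord_max) in
       (p', [ffun i => if i == ord0 then a0 else a1])).

Local Notation tape := (tape two_tape_machine).
Local Notation config := (config two_tape_machine).
Local Notation mk_tape := (@Tape _ two_tape_machine).
Local Notation tape_move := (@move _ two_tape_machine).
Local Notation tape_write := (@write _ two_tape_machine).
Implicit Types (t u : tape) (p : ctrl) (c : config).

(** Lists for the same tape may differ in trailing blanks, which moves of the head create; reading
    cells with default [None] hides them. *)
Definition tape_eq t u : Prop :=
  [/\ Defs.thead t = Defs.thead u, nth None (tleft t) =1 nth None (tleft u)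
    & nth None (tright t) =1 nth None (tright u)].

Lemma tape_eq_trans t u v : tape_eq t u -> tape_eq u v -> tape_eq t v.
Proof.
case=> h1 h2 h3 [h4 h5 h6].
by split=> [|i|i]; rewrite ?h1 ?h2 ?h3.
Qed.

Lemma tape_eq_act d a t u : tape_eq t u ->
  tape_eq (tape_move d (tape_write a t)) (tape_move d (tape_write a u)).
Proof.
case: t u => [l b r] [l' b' r'] [/= _ hl hr].
case: d => [[]|] //; split => //=; try by case.
- by rewrite -!nth0.
- by move=> i; rewrite !nth_behead.
- by rewrite -!nth0.
- by move=> i; rewrite !nth_behead.
Qed.

Definition is_config p t0 t1 c : Prop :=
  [/\ c.1 = p, tape_eq (c.2 ord0) t0 & tape_eq (c.2 ord_max) t1].

Definition reach n p t0 t1 p' t0' t1' : Prop :=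
  forall c, is_config p t0 t1 c ->
    exists2 m, m <= n & is_config p' t0' t1' (iter m (@step _ two_tape_machine) c).

Definition halts n p t0 t1 b : Prop :=
  exists p' t0' t1', halt p' = Some b /\ reach n p t0 t1 p' t0' t1'.

Lemma reach_refl n p t0 t1 : reach n p t0 t1 p t0 t1.
Proof. by move=> c hc; exists 0. Qed.

Lemma reach_trans n1 n2 p1 t01 t11 p2 t02 t12 p3 t03 t13 :
  reach n1 p1 t01 t11 p2 t02 t12 -> reach n2 p2 t02 t12 p3 t03 t13 ->
  reach (n1 + n2) p1 t01 t11 p3 t03 t13.
Proof.
move=> h1 h2 c /h1[m1 hm1 /h2[m2 hm2 hc]].
by exists (m2 + m1); rewrite ?iterD // addnC leq_add.
Qed.

Lemma reach_halts n1 n2 p1 t01 t11 p2 t02 t12 b :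
  reach n1 p1 t01 t11 p2 t02 t12 -> halts n2 p2 t02 t12 b ->
  halts (n1 + n2) p1 t01 t11 b.
Proof.
move=> h1 [p' [t0' [t1' [hp h2]]]]; exists p', t0', t1'; split=> //.
exact: reach_trans h1 h2.
Qed.

Lemma reach_le n n' p t0 t1 p' t0' t1' : n <= n' ->
  reach n p t0 t1 p' t0' t1' -> reach n' p t0 t1 p' t0' t1'.
Proof. by move=> le h c /h[m hm hc]; exists m => //; exact: leq_trans hm le. Qed.

Lemma halts_le n n' p t0 t1 b : n <= n' -> halts n p t0 t1 b -> halts n' p t0 t1 b.
Proof.
move=> le [p' [t0' [t1' [hp h]]]]; exists p', t0', t1'; split=> //.
exact: reach_le h.
Qed.

Lemma reach_step p t0 t1 p' u0 u1 (r := next p (Defs.thead t0) (Defs.thead t1)) :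
  halt p = None -> r.1.1 = p' ->
  tape_eq (tape_move r.1.2.2 (tape_write r.1.2.1 t0)) u0 ->
  tape_eq (tape_move r.2.2 (tape_write r.2.1 t1)) u1 ->
  reach 1 p t0 t1 p' u0 u1.
Proof.
rewrite {}/r => hp e e0 e1 [q T] [/= eq h0 h1]; exists 1 => //=; subst q.
rewrite /step /= hp !ffunE.
case: (h0) => -> _ _; case: (h1) => -> _ _.
case: (next _ _ _) e e0 e1 => [[q a0] a1] /= -> e0 e1.
split=> //=; rewrite !ffunE /=.
  exact: tape_eq_trans (tape_eq_act _ _ h0) e0.
exact: tape_eq_trans (tape_eq_act _ _ h1) e1.
Qed.

(** Three head positions: on the first cell of a text going right, on the last cell of a text listed
    from right to left, and on the blank cell above a stack listed from its top. *)
Definition right_tape l (s : seq symbol) : tape := mk_tape l (head None s) (behead s).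
Definition left_tape (s : seq symbol) r : tape := mk_tape (behead s) (head None s) r.
Definition stack_tape k : tape := mk_tape k None [::].

Lemma keep_tape t : tape_eq (tape_move None (tape_write (Defs.thead t) t)) t.
Proof. by case: t. Qed.

Lemma nth_blank (s : seq symbol) : nth None (rcons s None) =1 nth None s.
Proof. by move=> i; rewrite nth_rcons if_same; case: ltnP => // h; rewrite nth_default. Qed.

End TwoTapes.

(** * The machine exploring the sections of a word *)

(* Tape 0 holds the current word, tape 1 a stack of words still to be explored.
   [Copy]: push the input.
   [Sec x y todo c s]: push the section at [x]; [y] is the image of [x] under the
     prefix read so far, [s] tells whether all ranks were kept.
   [Rew todo c]: rewind tape 0, then treat the next letter of [todo].
   [Fwd]: go to the right end of tape 0.
   [Pop0], [Pop1], [PopW c nt]: replace the current word by the top of the stack. *)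
Inductive phase (X : finType) (p : nat) :=
  | Copy
  | Sec of X & X & {set X} & 'I_p.+1 & bool
  | Rew of {set X} & 'I_p.+1
  | Fwd
  | Pop0
  | Pop1
  | PopW of 'I_p.+1 & bool
  | Halt of bool.
Arguments Copy {X p}.
Arguments Fwd {X p}.
Arguments Pop0 {X p}.
Arguments Pop1 {X p}.
Arguments PopW {X p}.
Arguments Halt {X p}.

Section PhaseFinite.
Variables (X : finType) (p : nat).

Definition phase_code : finType :=
  ((X * X * {set X} * 'I_p.+1 * bool) + ({set X} * 'I_p.+1) + ('I_p.+1 * bool)
   + bool + 'I_4)%type.

Definition encode_phase (q : phase X p) : phase_code :=
  match q with
  | Sec x y todo c s => inl (inl (inl (inl (x, y, todo, c, s))))
  | Rew todo c => inl (inl (inl (inr (todo, c))))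
  | PopW c nt => inl (inl (inr (c, nt)))
  | Halt b => inl (inr b)
  | Copy => inr (@inord 3 0)
  | Fwd => inr (@inord 3 1)
  | Pop0 => inr (@inord 3 2)
  | Pop1 => inr (@inord 3 3)
  end.

Definition decode_phase (z : phase_code) : phase X p :=
  match z with
  | inl (inl (inl (inl (x, y, todo, c, s)))) => Sec x y todo c s
  | inl (inl (inl (inr (todo, c)))) => Rew todo c
  | inl (inl (inr (c, nt))) => PopW c nt
  | inl (inr b) => Halt b
  | inr i => match val i with 0 => Copy | 1 => Fwd | 2 => Pop0 | _ => Pop1 end
  end.

Lemma encode_phaseK : cancel encode_phase decode_phase.
Proof. by case=> //=; rewrite inordK. Qed.

HB.instance Definition _ := Finite.copy (phase X p) (can_type encode_phaseK).

End PhaseFinite.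

Section Machine.
Variables (X : finType) (A : automaton X) (rank : astate A -> nat).
Hypothesis rankP : ranked rank.
Variable patience : nat.
Variables (Sigma : finType) (input_state : Sigma -> astate A).
Local Notation S := (astate A).
Local Notation count := 'I_patience.+1.
Local Notation work := (S + count)%type.
Local Notation symbol := (option (Sigma + work)).
Local Notation action := (symbol * option bool)%type.
Local Notation ctrl := (phase X patience).
Local Notation alive := (alive rank patience).
Local Notation good := (good rank patience).
Local Notation potential := (potential rank patience).
Implicit Types (ws : seq S) (x y : X) (todo : {set X}).

Definition halting (p : ctrl) : option bool := if p is Halt b then Some b else None.

Definition symbol_state (a : symbol) : option S :=
  match a with
  | Some (inl l) => Some (input_state l)
  | Some (inr (inl q)) => Some q
  | _ => None
  end.

Local Arguments symbol_state : simpl never.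

Definition state_symbol (q : S) : symbol := Some (inr (inl q)).
Definition count_symbol (c : nat) : symbol := Some (inr (inr (inord c))).

Notation Lft := (Some false).
Notation Rgt := (Some true).
Notation Stay := (@None bool).

Definition next_phase (p : ctrl) (a b : symbol) : ctrl * action * action :=
  match p with
  | Copy =>
    if symbol_state a is Some q then (Copy, (a, Rgt), (state_symbol q, Rgt))
    else (Pop0, (a, Stay), (count_symbol 0, Rgt))
  | Sec x y todo c s =>
    if symbol_state a is Some q then
      (Sec x (output q y) todo c (s && (rank (trans q y) == rank q)),
       (a, Rgt), (state_symbol (trans q y), Rgt))
    else if y == x then
      (Rew todo c, (a, Lft), (count_symbol (if s then c.+1 else 0), Rgt))
    else (Halt false, (a, Stay), (b, Stay))
  | Rew todo c =>
    if symbol_state a is Some _ then (Rew todo c, (a, Lft), (b, Stay))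
    else (if [pick x in todo] is Some x then Sec x x (todo :\ x) c true else Fwd,
          (a, Rgt), (b, Stay))
  | Fwd =>
    if symbol_state a is Some _ then (Fwd, (a, Rgt), (b, Stay))
    else (Pop0, (a, Stay), (b, Stay))
  | Pop0 => (Pop1, (a, Lft), (b, Lft))
  | Pop1 =>
    if b is Some (inr (inr c)) then (PopW c false, (a, Stay), (None, Lft))
    else (Halt true, (a, Stay), (b, Stay))
  | PopW c nt =>
    if symbol_state b is Some q then
      (PopW c (nt || (0 < rank q)), (state_symbol q, Lft), (None, Lft))
    else (Rew (if nt && (c < patience) then finset.setT else finset.set0) c, (a, Stay), (b, Rgt))
  | Halt v => (Halt v, (a, Stay), (b, Stay))
  end.

Definition section_machine : turing_machine Sigma :=
  two_tape_machine (Copy : ctrl) halting next_phase.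

Local Notation reach := (@reach _ _ _ (Copy : ctrl) halting next_phase).
Local Notation halts := (@halts _ _ _ (Copy : ctrl) halting next_phase).
Local Notation rt := (@right_tape _ _ _ (Copy : ctrl) halting next_phase).
Local Notation lt := (@left_tape _ _ _ (Copy : ctrl) halting next_phase).
Local Notation stk := (@stack_tape _ _ _ (Copy : ctrl) halting next_phase).

(** * Runs of the single phases *)

Definition spells (zs : seq symbol) ws : Prop :=
  map symbol_state zs = map Some ws.

Lemma size_spells zs ws : spells zs ws -> size zs = size ws.
Proof. by move=> /(congr1 size); rewrite !size_map. Qed.

(** A section is written from left to right, so its last letter lies nearest to the top. The counter
    is pushed after it, because only then is it known whether all ranks were kept. *)
Definition item_cells (it : nat * seq S) : seq symbol :=
  count_symbol it.1 :: rev (map state_symbol it.2).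

Definition stack_cells (st : seq (nat * seq S)) : seq symbol :=
  flatten (map item_cells st).

Lemma copy_run ws zs l k : spells zs ws ->
  reach (size ws) Copy (rt l zs) (stk k)
        Copy (rt (rev zs ++ l) [::]) (stk (rev (map state_symbol ws) ++ k)).
Proof.
elim: ws zs l k => [|q ws IH] [|a zs] l k // hz; first exact: reach_refl.
case: hz => ha hz.
rewrite -[size _]/(1 + size ws) !rev_cons !cat_rcons.
apply: (reach_trans _ (IH _ _ _ hz)).
by apply: reach_step; rewrite /= ?ha.
Qed.

Lemma sec_run ws zs l k x y todo c s : spells zs ws ->
  reach (size ws) (Sec x y todo c s) (rt l zs) (stk k)
    (Sec x (word_output ws y) todo c (s && stays rank ws y))
    (rt (rev zs ++ l) [::]) (stk (rev (map state_symbol (word_section ws y)) ++ k)).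
Proof.
elim: ws zs l k y s => [|q ws IH] [|a zs] l k y s // hz.
  by rewrite andbT; exact: reach_refl.
case: hz => ha hz.
rewrite -[size _]/(1 + size ws) /= !rev_cons !cat_rcons andbA.
apply: (reach_trans _ (IH _ _ _ _ _ hz)).
by apply: reach_step; rewrite /= ?ha.
Qed.

Lemma rewind_run ws zs r t todo c : spells zs ws ->
  reach (size ws) (Rew todo c) (lt zs r) t (Rew todo c) (lt [::] (rev zs ++ r)) t.
Proof.
elim: ws zs r => [|q ws IH] [|a zs] r // hz; first exact: reach_refl.
case: hz => ha hz.
rewrite -[size _]/(1 + size ws) rev_cons cat_rcons.
apply: (reach_trans _ (IH _ _ hz)).
by apply: reach_step; rewrite /= ?ha //; exact: keep_tape.
Qed.

Lemma forward_run ws zs l t : spells zs ws ->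
  reach (size ws) Fwd (rt l zs) t Fwd (rt (rev zs ++ l) [::]) t.
Proof.
elim: ws zs l => [|q ws IH] [|a zs] l // hz; first exact: reach_refl.
case: hz => ha hz.
rewrite -[size _]/(1 + size ws) rev_cons cat_rcons.
apply: (reach_trans _ (IH _ _ hz)).
by apply: reach_step; rewrite /= ?ha //; exact: keep_tape.
Qed.

(** All words of the search have the same length, so the popped word, coming last letter first,
    exactly overwrites the current one from right to left. *)
Lemma pop_run ys l r k c nt : size l = size ys ->
  reach (size ys) (PopW c nt) (lt l r) (lt (map state_symbol ys ++ k) [::])
    (PopW c (nt || nontriv rank ys))
    (lt [::] (rev (map state_symbol ys) ++ r)) (lt k [::]).
Proof.
elim: ys l r nt => [|q ys IH] [|a l] r nt // hl.
  by rewrite orbF; exact: reach_refl.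
case: hl => hl.
rewrite -[size _]/(1 + size ys) /= !rev_cons !cat_rcons orbA.
apply: (reach_trans _ (IH _ _ _ hl)).
apply: reach_step => //=.
by split=> //=; exact: (nth_blank [::]).
Qed.

Definition child c ws x : nat * seq S := (next_count rank c ws x, word_section ws x).

Local Notation round n := (2 * n.+1).

Lemma finish_run ws zs c k : spells zs ws ->
  reach (size ws).+2 (Rew finset.set0 c) (lt [::] zs) (stk k)
    Pop0 (rt (rev zs) [::]) (stk k).
Proof.
move=> hz; apply: (@reach_le _ _ _ _ _ _ (1 + (size ws + 1))); first by lia.
apply: (reach_trans (p2 := Fwd) (t02 := rt [::] zs) (t12 := stk k)).
  apply: reach_step => //=.
    by case: pickP => // x; rewrite !inE.
  by split=> //=; exact: (nth_blank [::]).
apply: (reach_trans (p2 := Fwd) (t02 := rt (rev zs) [::]) (t12 := stk k)).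
  by have := forward_run (l := [::]) (t := stk k) hz; rewrite cats0.
exact: reach_step.
Qed.

Lemma section_start ws zs todo x c k : [pick x in todo] = Some x -> spells zs ws ->
  reach (size ws).+1 (Rew todo c) (lt [::] zs) (stk k)
    (Sec x (word_output ws x) (todo :\ x) c (stays rank ws x))
    (rt (rev zs) [::]) (stk (rev (map state_symbol (word_section ws x)) ++ k)).
Proof.
move=> hx hz; apply: (@reach_le _ _ _ _ _ _ (1 + size ws)) => //.
apply: (reach_trans (p2 := Sec x x (todo :\ x) c true) (t02 := rt [::] zs)
  (t12 := stk k)).
  apply: reach_step => //=; first by rewrite hx.
  by split=> //=; exact: (nth_blank [::]).
by have := sec_run (l := [::]) (k := k) (x := x) (y := x) (todo := todo :\ x) (c := c) (s := true) hz; rewrite cats0.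
Qed.

Lemma section_run ws zs todo x c k : [pick x in todo] = Some x -> spells zs ws ->
  c < patience -> word_output ws x = x ->
  reach (round (size ws)) (Rew todo (inord c)) (lt [::] zs) (stk k)
    (Rew (todo :\ x) (inord c)) (lt [::] zs)
    (stk (item_cells (child c ws x) ++ k)).
Proof.
move=> hx hz hc ho.
apply: (@reach_le _ _ _ _ _ _ ((size ws).+1 + (1 + size ws))); first by lia.
apply: (reach_trans (section_start hx hz)); rewrite ho.
apply: (reach_trans (p2 := Rew (todo :\ x) (inord c)) (t02 := lt (rev zs) [::])
  (t12 := stk (item_cells (child c ws x) ++ k))).
  apply: reach_step => //=; rewrite eqxx //=.
    by split=> //=; exact: (nth_blank [::]).
  by rewrite inordK // ltnS ltnW.
have hz' : spells (rev zs) (rev ws) by rewrite /spells !map_rev hz.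
have := rewind_run (r := [::]) (t := stk (item_cells (child c ws x) ++ k))
  (todo := todo :\ x) (c := inord c) hz'.
by rewrite revK cats0 size_rev.
Qed.

Lemma section_reject ws zs todo x c k : [pick x in todo] = Some x -> spells zs ws ->
  word_output ws x <> x ->
  halts (round (size ws)) (Rew todo c) (lt [::] zs) (stk k) false.
Proof.
move=> hx hz /eqP/negPf ho.
apply: (@halts_le _ _ _ _ _ _ ((size ws).+1 + 1)); first by lia.
apply: (reach_halts (section_start hx hz)).
exists (Halt false), (rt (rev zs) [::]),
  (stk (rev (map state_symbol (word_section ws x)) ++ k)); split=> //.
by apply: reach_step => //=; rewrite ho.
Qed.

Lemma sections_run ws zs todo c k : spells zs ws -> c < patience ->
  (exists xs, [/\ uniq xs, xs =i todo, forall x, x \in todo -> word_output ws x = x &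
    reach (#|todo| * round (size ws) + (size ws).+2)
      (Rew todo (inord c)) (lt [::] zs) (stk k)
      Pop0 (rt (rev zs) [::]) (stk (stack_cells (map (child c ws) xs) ++ k))]) \/
  (exists x, word_output ws x <> x /\
    halts (#|todo| * round (size ws))
      (Rew todo (inord c)) (lt [::] zs) (stk k) false).
Proof.
move=> hz hc; have [m] := ubnP #|todo|.
elim: m todo k => [|m IH] todo k; first by rewrite ltn0.
rewrite ltnS => htodo.
case ex: [pick x in todo] => [x|]; last first.
  have -> : todo = finset.set0.
    by apply/setP => x; rewrite inE; case: pickP ex => // /(_ x).
  left; exists [::]; split=> // [x|x|]; rewrite ?inE // cards0.
  exact: finish_run.
have hx : x \in todo by case: pickP ex => // y hy [<-].
have card_todo : #|todo| = #|todo :\ x|.+1 by rewrite (cardsD1 x todo) hx.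
case: (pselect (word_output ws x = x)) => [ho|ho]; last first.
  right; exists x; split=> //.
  apply: (@halts_le _ _ _ _ _ _ (round (size ws))).
    by rewrite card_todo mulSn leq_addr.
  exact: section_reject ex hz ho.
have run := section_run (k := k) ex hz hc ho.
case: (IH (todo :\ x) (item_cells (child c ws x) ++ k)); first by lia.
  case=> xs [uxs exs hos run']; left; exists (rcons xs x); split.
  - by rewrite rcons_uniq uxs exs !inE eqxx.
  - move=> y; rewrite mem_rcons in_cons exs !inE.
    by case: eqP => [->|].
  - move=> y hy; case: (eqVneq y x) => [->//|yx].
    by apply: hos; rewrite !inE yx.
  apply: (@reach_le _ _ _ _ _ _ (round (size ws) +
    (#|todo :\ x| * round (size ws) + (size ws).+2))).
    by rewrite card_todo mulSn addnA.
  apply: (reach_trans run).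
  move: run'; rewrite map_rcons /stack_cells map_rcons flatten_rcons.
  by rewrite -catA.
case=> y [hy hh]; right; exists y; split=> //.
apply: (@halts_le _ _ _ _ _ _ (round (size ws) + #|todo :\ x| * round (size ws))).
  by rewrite card_todo mulSn.
exact: reach_halts run hh.
Qed.

Lemma pop_item c ws zs st : c <= patience -> size zs = size ws ->
  exists zs', spells zs' ws /\
    reach (size ws + 3) Pop0 (rt (rev zs) [::]) (stk (stack_cells ((c, ws) :: st)))
      (Rew (if alive c ws then finset.setT else finset.set0) (inord c))
      (lt [::] zs') (stk (stack_cells st)).
Proof.
move=> hc hs; exists (map state_symbol ws); split.
  by rewrite /spells -map_comp.
set k := stack_cells st.
have -> : stack_cells ((c, ws) :: st) =
    count_symbol c :: map state_symbol (rev ws) ++ k by rewrite map_rev.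
apply: (@reach_le _ _ _ _ _ _ (1 + (1 + (size ws + 1)))); first by lia.
apply: (reach_trans (p2 := Pop1) (t02 := lt (rev zs) [::])
  (t12 := lt (count_symbol c :: map state_symbol (rev ws) ++ k) [::])).
  by apply: reach_step => //=; split=> //=; exact: (nth_blank [::]).
apply: (reach_trans (p2 := PopW (inord c) false) (t02 := lt (rev zs) [::])
  (t12 := lt (map state_symbol (rev ws) ++ k) [::])).
  by apply: reach_step => //=; split=> //=; exact: (nth_blank [::]).
apply: (reach_trans (p2 := PopW (inord c) (nontriv rank ws))
  (t02 := lt [::] (map state_symbol ws)) (t12 := lt k [::])).
  have hs' : size (rev zs) = size (rev ws) by rewrite !size_rev.
  have := pop_run (r := [::]) (k := k) (c := inord c) (nt := false) hs'.
  by rewrite /nontriv has_rev map_rev revK cats0 size_rev.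
have hk : symbol_state (head None k) = None by rewrite /k; case: (st).
apply: reach_step => //=; rewrite hk //=.
  by rewrite inordK.
by case: (k) => [|a k'] //; split=> //=; exact: (nth_blank [::]).
Qed.

(** * The search loop and its running time *)

Definition total_potential (st : seq (nat * seq S)) : nat :=
  \sum_(it <- st) potential it.1 it.2.

Lemma total_potential_cat st st' :
  total_potential (st ++ st') = total_potential st + total_potential st'.
Proof. exact: big_cat. Qed.

(** [n + 3] steps to pop an item, at most [#|X|] rounds of [2 * n.+1] steps for its sections, and
    [n.+2] steps to return to the right end. *)
Definition loop_time n : nat := (2 * #|X| + 2) * n.+1 + 3.

(** An iteration that does not reject replaces the top item by its children, of smaller total
    potential, or drops it when it is not alive. As potentials are positive, there are at most
    [total_potential st] iterations before one that finds the stack empty. *)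
Lemma explore st zs n : size zs = n ->
  (forall it, it \in st -> it.1 <= patience /\ size it.2 = n) ->
  exists b, halts ((total_potential st).+1 * loop_time n)
      Pop0 (rt (rev zs) [::]) (stk (stack_cells st)) b /\
    (b = true <-> forall it, it \in st -> good it.1 it.2).
Proof.
have [m] := ubnP (total_potential st).
elim: m st zs => [|m IH] st zs; first by rewrite ltn0.
rewrite ltnS => hm hzs.
case: st hm => [|[c ws] st] hm hst.
  exists true; split=> //; exists (Halt true), (lt (rev zs) [::]), (lt [::] [::]).
  split=> //; apply: (@reach_le _ _ _ _ _ _ (1 + 1)); first by rewrite /loop_time; lia.
  apply: (reach_trans (p2 := Pop1) (t02 := lt (rev zs) [::]) (t12 := lt [::] [::])).
    by apply: reach_step => //=; split=> //=; exact: (nth_blank [::]).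
  by apply: reach_step => //=; exact: keep_tape.
have [/= hc hw] := hst _ (mem_head _ _).
have hst' it : it \in st -> it.1 <= patience /\ size it.2 = n.
  by move=> h; apply: hst; rewrite in_cons h orbT.
have [zs' [hz' run]] := pop_item st hc (etrans hzs (esym hw)).
have potE : total_potential ((c, ws) :: st) = potential c ws + total_potential st.
  by rewrite /total_potential big_cons.
rewrite potE in hm *.
have szs' : size zs' = n by rewrite (size_spells hz').
case: (boolP (alive c ws)) => al; last first.
  rewrite (negPf al) in run.
  have good_cw : good c ws by split=> h; rewrite h in al.
  have [|b [hh hb]] := IH st zs' _ szs' hst'.
    by apply: leq_trans hm; rewrite -add1n leq_add2r.
  exists b; split.
    have hh' := reach_halts (reach_trans run (finish_run hz')) hh.
    apply: halts_le hh'.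
    rewrite hw [leqRHS]mulSn; apply: leq_add; first by rewrite /loop_time; lia.
    by rewrite leq_mul2r /potential addSn ltnS leq_addl orbT.
  rewrite hb; split=> h it; first by rewrite in_cons => /orP[/eqP ->|/h].
  by move=> hit; apply: h; rewrite in_cons hit orbT.
rewrite al in run.
have [_ hc'] := andP al.
have [[xs [uxs exs ho run']]|[x [hx hh]]] := sections_run finset.setT (stack_cells st) hz' hc'.
  have pot_xs : total_potential (map (child c ws) xs) < potential c ws.
    apply: leq_trans (potential_children rankP al).
    rewrite /total_potential big_map big_uniq // ltnS; apply: eq_leq.
    by apply: eq_bigl => x; rewrite exs inE.
  have [||b [hh hb]] := IH (map (child c ws) xs ++ st) zs' _ szs'.
  - by rewrite total_potential_cat; lia.
  - move=> it; rewrite mem_cat => /orP[/mapP[x _ ->]|/hst'//] /=.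
    by rewrite /next_count size_word_section; case: ifP.
  exists b; split.
    move: run'; rewrite /stack_cells -flatten_cat -map_cat => run'.
    have hh' := reach_halts (reach_trans run run') hh.
    apply: halts_le hh'.
    rewrite hw [leqRHS]mulSn cardsT; apply: leq_add; first by rewrite /loop_time; lia.
    by rewrite leq_mul2r total_potential_cat -addSn leq_add2r pot_xs orbT.
  rewrite hb; split=> h it.
    rewrite in_cons => /orP[/eqP -> /=|hit].
      split=> _ x; first by apply: ho; rewrite inE.
      by apply: (h (child c ws x)); rewrite mem_cat map_f // exs inE.
    by apply: h; rewrite mem_cat hit orbT.
  rewrite mem_cat => /orP[/mapP[x _ ->]|hit].
    by have [_ /(_ al x)] := h _ (mem_head _ _).
  by apply: h; rewrite in_cons hit orbT.
exists false; split.
  apply: halts_le (reach_halts run hh).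
  rewrite hw [leqRHS]mulSn cardsT; apply: leq_trans (leq_addr _ _).
  by rewrite /loop_time; lia.
split=> // h; have [/(_ al x) /= hx' _] := h _ (mem_head _ _).
by case: hx.
Qed.

Lemma section_machine_decides (w : seq Sigma) :
  #|{ffun S -> S}| <= patience ->
  exists t b, [/\ t <= (potential 0 (map input_state w) + 2) * loop_time (size w),
    verdict (iter t (@step _ section_machine) (initial section_machine w)).1 = Some b
    & b = true <-> word_trivial (map input_state w)].
Proof.
move=> patienceP; set ws := map input_state w.
pose zs : seq symbol := map (fun a => Some (inl a)) w.
have hz : spells zs ws by rewrite /spells /zs /ws -!map_comp.
have zw : size zs = size w by rewrite size_map.
have sw : size ws = size w by rewrite size_map.
have start : reach ((size w).+1) Copy (rt [::] zs) (stk [::])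
    Pop0 (rt (rev zs) [::]) (stk (stack_cells [:: (0, ws)])).
  have := copy_run (l := [::]) (k := [::]) hz; rewrite !cats0 sw => run.
  apply: (@reach_le _ _ _ _ _ _ (size w + 1)); first by rewrite addn1.
  apply: (reach_trans run).
  apply: reach_step => //=.
  by rewrite /stack_cells /= cats0.
have [|b [hb gb]] := explore (st := [:: (0, ws)]) zw.
  by move=> it; rewrite inE => /eqP ->.
have [p [t0 [t1 [hp]]]] := reach_halts start hb.
move=> /(_ (initial section_machine w)) [|t ht [ep _ _]]; first by split.
exists t, b; split.
(* Of the two extra [loop_time], one covers copying the input, the other the final test of the empty
   stack. *)
- apply: leq_trans ht _; rewrite /total_potential big_seq1 addn2 [leqRHS]mulSn.
  by rewrite leq_add2r /loop_time; lia.
- by rewrite ep.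
rewrite gb; split=> [/(_ _ (mem_head _ _))|triv it].
  exact: good_word_trivial.
by rewrite inE => /eqP ->; exact: word_trivial_good.
Qed.

End Machine.

(** * Polynomial time for subgroups of [Pol] *)

Theorem corollary2 (X : finType) (hX : 1 < #|X|) (m : int) (hm : (-1 <= m)%R)
    (H : set (bijection (omega X))) (k : nat) (g : 'I_k -> bijection (omega X))
    (genH : H = generated_subgroup g) (HPol : (H `<=` Pol X m)%classic) :
  decidable_in_subexponential_time (word_problem g).
Proof.
have genP i : exists (A : automaton X) (rank : astate A -> nat) (s : astate A),
    ranked rank /\ transform s = g i.
  apply/(@Pol_ranked _ m)/HPol; rewrite genH; exists [:: (i, false)].
  by rewrite /word_value big_seq1.
have [A [rank [q [rankP hq]]]] := letter_states genP.
pose patience := #|{ffun astate A -> astate A}|.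
have [C [e hC]] := potential_bound rankP patience.
(* Chosen so that [loop_time n <= D * n.+1]. *)
pose D := 2 * #|X| + 5.
exists (section_machine rank patience q), (fun n => (C + 2) * D * n.+1 ^ e.+1).
split; last exact: polynomial_subexponential.
move=> w; have [t [b [ht hv hb]]] := section_machine_decides rankP q w (leqnn patience).
exists t, b; split=> //; last by rewrite hb /word_problem (word_value_trivial hq).
rewrite expnSr mulnACA; apply: leq_trans ht (leq_mul _ _).
  have := hC (map q w); rewrite size_map mulnDl => hCw.
  by rewrite leq_add // leq_pmulr // expn_gt0.
by rewrite /loop_time /D; lia.
Qed.
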